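(* Let $X$ be a complex Banach space, $T\in B(X)$ and $\beta\ge1$. Then $T$ is uniformly $\beta$-Kreiss bounded if and only if $$\sup_{\lambda\in\mathbb{T}}\ \sup_{n\in\mathbb{N}}\ \big\|(n+1)^{-\beta}S_n^1(\lambda T)\big\|<\infty.$$
   Context: $\mathbb{N}=\{1,2,\dots\}$; $\mathbb{T}$ is the unit circle in $\mathbb{C}$; $S_n^1(T):=\sum_{j=0}^n T^j$. $T\in B(X)$ is uniformly $\beta$-Kreiss bounded if there is $C>0$ such that $\Big\|\sum_{j=0}^n \frac{T^j}{\lambda^{j+1}}\Big\|\le\frac{C}{(|\lambda|-1)^{\beta}}$ for all $1<|\lambda|<2$ and all $n\in\mathbb{N}$. *)

(* Defs.v *)
From HB Require Import structures.
From mathcomp Require Export all_boot all_order all_algebra.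
From mathcomp Require Export complex.
From mathcomp Require Export all_classical all_reals all_analysis.
Export Order.TTheory GRing.Theory Num.Theory.
Export numFieldNormedType.Exports.

Set Implicit Arguments.
Unset Strict Implicit.
Unset Printing Implicit Defensive.

Local Open Scope classical_set_scope.
Local Open Scope ring_scope.
Local Open Scope complex_scope.

Definition unit_circle (R : realType) : set R[i] := [set z | `|z| = 1].
Arguments unit_circle R : clear implicits.

Section operators.
Context {R : realType} {X : normedModType R[i]}.

(* On a normed module over R[i] the norm `|x| is an element of R[i], with zero
   imaginary part; Re reads it in R. Sums and scalings of operators below are
   those of the pointwise module of functions X -> X. *)
Definition opnorm (T : X -> X) : \bar R :=
  ereal_sup [set (complex.Re `|T x|)%:E | x in [set x : X | `|x| <= 1]].

Definition S1 (n : nat) (T : X -> X) : X -> X := \sum_(0 <= j < n.+1) iter j T.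

Definition uniformly_Kreiss_bounded (beta : R) (T : X -> X) : Prop :=
  exists C : R, 0 < C /\
    forall (lambda : R[i]) (n : nat), 1 < `|lambda| < 2 -> (0 < n)%N ->
      (opnorm (\sum_(0 <= j < n.+1) lambda ^- j.+1 *: iter j T)%R
         <= ((C / (complex.Re `|lambda| - 1) `^ beta)%R)%:E)%E.

End operators.

(* Main.v *)
(* Abel summation, along the orbits v_j = (l T)^j x with |l| = 1.
   If the damped sums \sum_(j <= k) r^-(j+1) v_j are at most D for all k <= n,
   then undamping them costs a factor 2 r^(n+1), which is at most 2 e for
   r = 1 + 1/(n+1), while D is then of order (n+1)^beta.
   Conversely, if |\sum_(j <= k) v_j| <= M (k+1)^beta, the damped sum is at most
   M (r^-(n+1) (n+1)^beta + (r - 1) \sum_(j < n) r^-(j+2) (j+1)^beta); with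
   q = sqrt r one has k^beta q^-k = O((r - 1)^-beta), and the remaining
   (q - 1) \sum q^-(j+1) telescopes. *)
Require Import Defs.
From mathcomp Require Import ring lra.

Set Implicit Arguments.
Unset Strict Implicit.
Unset Printing Implicit Defensive.

Local Open Scope classical_set_scope.
Local Open Scope ring_scope.
Local Open Scope complex_scope.

(** * Summation by parts and undamping *)

Lemma abel_summation (K : nzRingType) (V : lmodType K) (a : nat -> K)
    (v : nat -> V) (n : nat) :
  \sum_(0 <= j < n.+1) a j *: v j =
  a n *: (\sum_(0 <= j < n.+1) v j) +
  \sum_(0 <= j < n) (a j - a j.+1) *: (\sum_(0 <= i < j.+1) v i).
Proof.
elim: n => [|n IH]; first by rewrite !big_nat1 big_nil addr0.
rewrite big_nat_recr //= IH [\sum_(0 <= j < n.+2) v j]big_nat_recr //=.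
rewrite [\sum_(0 <= j < n.+1) (a j - _) *: _]big_nat_recr //=.
rewrite scalerDr scalerBl [RHS]addrC -[RHS]addrA [X in _ = _ + X]addrA subrK.
by rewrite addrCA addrA.
Qed.

Section realnorm.
Context {R : realType} {X : normedModType R[i]}.
Implicit Types x y : X.

Definition nrm x : R := complex.Re `|x|.

Lemma nrmE x : `|x| = (nrm x)%:C.
Proof. by rewrite /nrm RRe_real // normr_real. Qed.

Lemma nrm_ge0 x : 0 <= nrm x.
Proof. by rewrite -lecR -nrmE normr_ge0. Qed.

Lemma nrm0 : nrm 0 = 0.
Proof. by rewrite /nrm normr0. Qed.

Lemma ler_nrmD x y : nrm (x + y) <= nrm x + nrm y.
Proof. by rewrite -lecR rmorphD /= -!nrmE ler_normD. Qed.

Lemma nrm_unitZ (l : R[i]) x : `|l| = 1 -> nrm (l *: x) = nrm x.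
Proof. by move=> l1; rewrite /nrm normrZ l1 mul1r. Qed.

Lemma nrm_realZ (a : R) x : nrm (a%:C *: x) = `|a| * nrm x.
Proof.
apply: complexI; rewrite -nrmE normrZ nrmE rmorphM /=; congr (_ * _).
by rewrite normc_def /= expr0n /= addr0 sqrtr_sqr.
Qed.

Lemma ler_nrm_sum (v : nat -> X) m n :
  nrm (\sum_(m <= j < n) v j) <= \sum_(m <= j < n) nrm (v j).
Proof.
elim/big_ind2 : _ => //; first by rewrite nrm0.
by move=> x r y s xr ys; rewrite (le_trans (ler_nrmD _ _)) ?lerD.
Qed.

Lemma ler_nrm_abel (a B : nat -> R) (v : nat -> X) (n : nat) :
  (forall k, (k <= n)%N -> nrm (\sum_(0 <= j < k.+1) v j) <= B k) ->
  nrm (\sum_(0 <= j < n.+1) (a j)%:C *: v j) <=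
  `|a n| * B n + \sum_(0 <= j < n) `|a j - a j.+1| * B j.
Proof.
move=> vB; rewrite abel_summation (le_trans (ler_nrmD _ _))// lerD//.
  by rewrite nrm_realZ ler_wpM2l// vB.
rewrite (le_trans (ler_nrm_sum _ _ _))// ler_sum_nat// => j /andP[_ jn].
by rewrite -rmorphB nrm_realZ ler_wpM2l// vB// ltnW.
Qed.

(** The weights [r ^+ j.+1] increase, so the Abel differences telescope to [r ^+ n.+1 - r]; with the
    boundary weight [r ^+ n.+1] the total is at most [2 * r ^+ n.+1]. *)
Lemma sum_of_damped_le (r D : R) (v : nat -> X) (n : nat) : 1 <= r ->
  (forall k, (k <= n)%N ->
     nrm (\sum_(0 <= j < k.+1) (r ^- j.+1)%:C *: v j) <= D) ->
  nrm (\sum_(0 <= j < n.+1) v j) <= 2 * r ^+ n.+1 * D.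
Proof.
move=> r1 vD.
have r0 : 0 < r by rewrite (lt_le_trans _ r1).
have D0 : 0 <= D by rewrite (le_trans (nrm_ge0 _) (vD 0 _)).
have -> : \sum_(0 <= j < n.+1) v j =
    \sum_(0 <= j < n.+1) (r ^+ j.+1)%:C *: ((r ^- j.+1)%:C *: v j).
  apply: eq_bigr => j _.
  by rewrite scalerA -rmorphM /= divff ?scale1r// expf_neq0// gt_eqF.
apply: le_trans (ler_nrm_abel (fun j => r ^+ j.+1) (B := fun=> D) vD) _.
rewrite ger0_norm ?exprn_ge0 ?(ltW r0)//.
rewrite -mulr_suml -mulrDl ler_wpM2r//.
under eq_bigr => j _.
  rewrite distrC ger0_norm; last by rewrite subr_ge0 ler_weXn2l.
  over.
rewrite (telescope_sumr (fun j => r ^+ j.+1))// expr1.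
by rewrite mulr_natl mulr2n lerD2l gerBl ltW.
Qed.

End realnorm.

(** * Polynomial growth against geometric decay *)

Lemma expR1D_le (R : realType) (u : R) : 0 <= u <= 1 -> expR (u / 2) <= 1 + u.
Proof.
move=> /andP[u0 u1].
(* It remains that [(1 + u) * (1 - u / 2) = 1 + u * (1 - u) / 2], which is at least 1 on the unit
   interval. *)
have h : 1 - u / 2 <= expR (- (u / 2)) by exact: expR_ge1Dx.
rewrite -[leLHS]mul1r -ler_pdivlMr ?expR_gt0// -expRN.
rewrite (le_trans _ (ler_wpM2l _ h)) ?addr_ge0//; nra.
Qed.

(** Raise [y <= expR y] to the power [b] at [y = k * u / (2 * b)]: the scale [2 * b] makes the right
    side [expR (u / 2) ^+ k], which [expR1D_le] bounds. *)
Lemma powR_le_exprn (R : realType) (b u : R) (k : nat) : 0 < b -> 0 <= u <= 1 ->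
  (k%:R * u) `^ b <= (2 * b) `^ b * (1 + u) ^+ k.
Proof.
move=> b0 u01; have /andP[u0 u1] := u01.
have -> : k%:R * u = 2 * b * (k%:R * u / (2 * b)).
  by rewrite [RHS]mulrC divfK// gt_eqF// mulr_gt0.
rewrite powRM ?divr_ge0 ?mulr_ge0 ?(ltW b0)// ler_wpM2l ?powR_ge0//.
apply: (@le_trans _ _ (expR (u / 2) ^+ k)); last first.
  by rewrite lerXn2r ?nnegrE ?expR_ge0 ?addr_ge0 ?expR1D_le.
have -> : expR (u / 2) ^+ k = expR (k%:R * u / (2 * b)) `^ b.
  rewrite -expRM_natl -expRM; congr expR; field.
  by rewrite gt_eqF.
rewrite ge0_ler_powR ?nnegrE ?expR_ge0 ?divr_ge0 ?mulr_ge0 ?(ltW b0)//.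
by rewrite (le_trans _ (expR_ge1Dx _))// lerDr.
Qed.

(* Half of the geometric decay, [q ^- k] with [q = sqrt r], absorbs the
   polynomial growth; the other half is left for summation. *)
Lemma powR_damped_le (R : realType) (b q : R) (k : nat) : 0 < b -> 1 < q < 2 ->
  k%:R `^ b * (q ^+ 2) ^- k <=
  (6 * b) `^ b / (q ^+ 2 - 1) `^ b * q ^- k.
Proof.
move=> b0 /andP[q1 q2].
have q0 : 0 < q by rewrite (lt_trans _ q1).
have s0 : 0 < q ^+ 2 - 1 by nra.
rewrite -exprM mulnC exprM expr2 invfM mulrA ler_wpM2r ?invr_ge0 ?exprn_ge0 ?(ltW q0)//.
rewrite ler_pdivrMr ?exprn_gt0// mulrAC ler_pdivlMr ?powR_gt0//.
rewrite -powRM ?(ltW s0)//.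
(* The 3 bounds [q + 1] in [q ^+ 2 - 1 = (q + 1) * (q - 1)]; the [2 * b] comes from [powR_le_exprn]
   with [u = q - 1]. *)
have -> : 6 * b = 3 * (2 * b) by ring.
rewrite [in leRHS]powRM ?mulr_ge0 ?(ltW b0)// -mulrA.
have h := @powR_le_exprn R b (q - 1) k b0.
have q1E : 1 + (q - 1) = q by rewrite addrC subrK.
rewrite q1E in h.
rewrite (le_trans _ (ler_wpM2l _ (h _))) ?powR_ge0//; last by apply/andP; split; lra.
have q10 : 0 <= q - 1 by lra.
rewrite -powRM ?mulr_ge0// ge0_ler_powR ?nnegrE ?mulr_ge0 ?(ltW b0) ?(ltW s0)//.
rewrite mulrCA ler_wpM2l//; nra.
Qed.

Lemma damped_sum_le (R : realType) (X : normedModType R[i]) (b M r : R)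
    (v : nat -> X) (n : nat) :
  0 < b -> 0 <= M -> 1 < r < 2 ->
  (forall k, nrm (\sum_(0 <= j < k.+1) v j) <= M * k.+1%:R `^ b) ->
  nrm (\sum_(0 <= j < n.+1) (r ^- j.+1)%:C *: v j) <=
  4 * M * (6 * b) `^ b / (r - 1) `^ b.
Proof.
move=> b0 M0 /andP[r1 r2] vM.
pose q := Num.sqrt r.
have qr : q ^+ 2 = r by rewrite sqr_sqrtr; lra.
have q0 : 0 <= q by rewrite sqrtr_ge0.
have q1 : 1 < q by nra.
have q2 : q < 2 by nra.
have q00 : 0 < q by lra.
pose L := M * ((6 * b) `^ b / (r - 1) `^ b).
have L0 : 0 <= L by rewrite mulr_ge0// divr_ge0 ?powR_ge0.
have key k : r ^- k * (M * k%:R `^ b) <= L * q ^- k.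
  rewrite mulrCA /L -mulrA ler_wpM2l// mulrC -qr.
  by rewrite powR_damped_le// q1.
apply: le_trans (ler_nrm_abel (fun j => r ^- j.+1)
  (B := fun k => M * k.+1%:R `^ b) (fun k _ => vM k)) _.
have rn0 k : 0 < r ^+ k by rewrite exprn_gt0; lra.
have qn0 k : 0 < q ^+ k by rewrite exprn_gt0.
(* The difference is [(1 - r^-1) * r ^- j.+1], and [1 - r^-1 <= r - 1 = (q + 1) * (q - 1) <= 3 * (q
   - 1)]; the factor [q - 1] turns [q ^- j.+1] into a telescoping difference. *)
have step j : `|r ^- j.+1 - r ^- j.+2| * (M * j.+1%:R `^ b) <=
    3 * L * (q ^- j - q ^- j.+1).
  have -> : r ^- j.+1 - r ^- j.+2 = (1 - r^-1) * r ^- j.+1.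
    rewrite [r ^+ j.+2]exprS; field.
    by rewrite !gt_eqF//; lra.
  have ri : 0 < r^-1 by rewrite invr_gt0; lra.
  have ri1 : 1 - r^-1 <= r - 1.
    have : r * r^-1 = 1 by rewrite divff// gt_eqF//; lra.
    nra.
  have ri2 : 0 <= 1 - r^-1 by rewrite subr_ge0 invf_le1//; lra.
  rewrite ger0_norm; last by rewrite mulr_ge0// invr_ge0 ltW.
  rewrite -[leLHS]mulrA (le_trans (ler_wpM2l ri2 (key _)))//.
  have -> : q ^- j - q ^- j.+1 = (q - 1) * q ^- j.+1.
    rewrite exprS; field.
    by rewrite !gt_eqF.
  rewrite [leLHS]mulrA [leRHS]mulrA ler_wpM2r ?invr_ge0 ?(ltW (qn0 _))//.
  rewrite (le_trans (ler_wpM2r L0 ri1))// mulrAC ler_wpM2r// -qr; nra.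
(* One [L] for the boundary term, [3 * L] for the telescoped sum. *)
have -> : 4 * M * (6 * b) `^ b / (r - 1) `^ b = L + 3 * L.
  rewrite /L; ring.
rewrite lerD//.
  rewrite ger0_norm ?invr_ge0 ?(ltW (rn0 _))// (le_trans (key _))//.
  by rewrite ler_piMr// invf_le1// exprn_ege1// ltW.
rewrite (le_trans (ler_sum_nat (fun j _ => step j)))//.
rewrite -mulr_sumr ler_piMr ?(mulr_ge0 _ L0)//.
under eq_bigr do rewrite -opprB.
rewrite sumrN (telescope_sumr (fun j => q ^- j))// opprB expr0 invr1.
by rewrite gerBl invr_ge0 ltW.
Qed.

Lemma expr1Dinv_le (R : realType) (n : nat) :
  (1 + n.+1%:R^-1) ^+ n.+1 <= expR 1 :> R.
Proof.
have -> : expR 1 = expR (n.+1%:R^-1) ^+ n.+1 :> R.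
  by rewrite -expRM_natl divff.
by rewrite lerXn2r ?nnegrE ?expR_ge0 ?addr_ge0 ?expR_ge1Dx.
Qed.

(** * From operator norms to bounds along orbits *)

Section operators.
Context {R : realType} {X : normedModType R[i]}.

Lemma opnorm_leP (A : X -> X) (M : R) :
  (opnorm A <= M%:E)%E <-> (forall x, `|x| <= 1 -> nrm (A x) <= M).
Proof.
split=> [AM x x1|AM].
  by rewrite -lee_fin (le_trans _ AM)//; apply: ereal_sup_ubound; exists x.
by apply: ge_ereal_sup => _ [x x1 <-]; rewrite lee_fin AM.
Qed.

Lemma iter_scale (T : {linear X -> X}) (l : R[i]) (j : nat) (x : X) :
  iter j (l *: (T : X -> X)) x = l ^+ j *: iter j T x.
Proof.
elim: j => [|j IH]; first by rewrite scale1r.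
by rewrite !iterS IH fctE linearZ scalerA -exprS.
Qed.

(* Writing the spectral parameter as [r / l] with [`|l| = 1] and [r > 1]. *)
Lemma Kreiss_rotationP (T : {linear X -> X}) (b : R) :
  uniformly_Kreiss_bounded b T <->
  exists C : R, 0 < C /\ forall (l : R[i]) (r : R) (n : nat) (x : X),
    `|l| = 1 -> 1 < r < 2 -> (0 < n)%N -> `|x| <= 1 ->
    nrm (\sum_(0 <= j < n.+1) (r ^- j.+1)%:C *: iter j (l *: (T : X -> X)) x)
      <= C / (r - 1) `^ b.
Proof.
have rotate (l : R[i]) (r : R) n x : `|l| = 1 ->
    nrm ((\sum_(0 <= j < n.+1) (r%:C / l) ^- j.+1 *: iter j T) x) =
    nrm (\sum_(0 <= j < n.+1) (r ^- j.+1)%:C *: iter j (l *: (T : X -> X)) x).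
  (* The coefficient [(r / l) ^- j.+1] contains [l ^+ j.+1], while the rotated iterate contributes
     only [l ^+ j]; the spare factor [l] has modulus one. *)
  move=> l1; rewrite -[RHS](nrm_unitZ _ l1) fct_sumE scaler_sumr.
  congr nrm; apply: eq_bigr => j _; rewrite iter_scale !scalerA fctE.
  congr (_ *: _); rewrite exprMn invfM exprVn invrK fmorphV rmorphXn /=.
  by rewrite mulrAC -exprS mulrC.
have annulusE (r : R) : (1 < r%:C < 2) = (1 < r < 2).
  by rewrite -[2 in LHS](rmorph_nat (@real_complex R)) !ltcR.
split=> -[C [C0 TC]]; exists C; split=> //.
  move=> l r n x l1 r12 n0 x1; rewrite -rotate//.
  have rE : `|r%:C / l| = r%:C.
    rewrite normrM normfV l1 invr1 mulr1 ger0_norm// lecR; lra.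
  have := TC (r%:C / l) n; rewrite rE annulusE => /(_ r12 n0) /opnorm_leP.
  exact.
move=> mu n mu12 n0; apply/opnorm_leP => x x1.
set r := complex.Re `|mu|.
have rE : `|mu| = r%:C by rewrite /r RRe_real // normr_real.
have r12 : 1 < r < 2 by rewrite -annulusE -rE.
have r0 : r%:C != 0 by rewrite -rE gt_eqF// (lt_trans ltr01)//; case/andP: mu12.
have mu0 : mu != 0 by rewrite -normr_eq0 rE.
have l1 : `|r%:C / mu| = 1 by rewrite -rE normrM normr_id normfV divff// rE.
have -> : mu = r%:C / (r%:C / mu) by rewrite invfM invrK mulVKf.
by rewrite rotate// TC.
Qed.

Lemma ereal_sup_S1P (T : X -> X) (b : R) :
  (ereal_sup [set ereal_sup [set opnorm
                ((n.+1%:R `^ (- b))%:C *: S1 n (lambda *: T))%R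
                | n in [set n : nat | (0 < n)%N]]
              | lambda in unit_circle R] < +oo)%E <->
  exists M : R, 0 <= M /\ forall (l : R[i]) (n : nat) (x : X),
    `|l| = 1 -> (0 < n)%N -> `|x| <= 1 ->
    nrm (\sum_(0 <= j < n.+1) iter j (l *: T) x) <= M * n.+1%:R `^ b.
Proof.
have boundE (l : R[i]) n x M :
    (nrm (((n.+1%:R `^ (- b))%:C *: S1 n (l *: T)) x) <= M) =
    (nrm (\sum_(0 <= j < n.+1) iter j (l *: T) x) <= M * n.+1%:R `^ b).
  rewrite fctE /S1 fct_sumE nrm_realZ ger0_norm ?powR_ge0// powRN mulrC.
  by rewrite ler_pdivrMr ?powR_gt0.
split=> [supfin|[M [M0 TM]]]; last first.
  apply: (@le_lt_trans _ _ M%:E); last exact: ltry.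
  apply: ge_ereal_sup => _ [l l1 <-]; apply: ge_ereal_sup => _ [n n0 <-].
  by apply/opnorm_leP => x x1; rewrite boundE TM.
set s := ereal_sup _ in supfin.
(* The maximum ensures the sign without a proof that [s] is non-negative; the formal case [s = -oo]
   is then trivial. *)
exists (Num.max 0 (fine s)); split; first by rewrite le_max lexx.
move=> l n x l1 n0 x1; rewrite -boundE.
apply: (opnorm_leP _ _).1 x x1.
apply: (@le_trans _ _ s).
  apply: le_trans (ereal_sup_ubound _); last by exists l.
  by apply: ereal_sup_ubound; exists n.
case: s supfin => [a|//|] _ //=; first by rewrite lee_fin le_max lexx orbT.
exact: leNye.
Qed.

End operators.

Theorem proposition5p10 (R : realType) (X : completeNormedModType R[i])
    (T : {linear X -> X}) (cT : continuous T) (beta : R) (beta_ge1 : 1 <= beta) :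
  uniformly_Kreiss_bounded beta T <->
  (ereal_sup [set ereal_sup [set opnorm
                ((n.+1%:R `^ (- beta))%:C *: S1 n (lambda *: (T : X -> X)))%R
                | n in [set n : nat | (0 < n)%N]]
              | lambda in unit_circle R] < +oo)%E.
Proof.
have b0 : 0 < beta by lra.
have pow_ge1 n : 1 <= n.+1%:R `^ beta.
  by rewrite -[leLHS](powRr0 n.+1%:R) ler_powR ?ler1n ?(ltW b0).
rewrite Kreiss_rotationP ereal_sup_S1P; split=> [[C [C0 TC]]|[M [M0 TM]]].
  (* [2 * expR 1] is the cost of undamping at [r = 1 + 1 / (n + 1)]; [C + 1] instead of [C] also
     covers the one-term sum. *)
  exists (2 * expR 1 * (C + 1)); split.
    by rewrite !mulr_ge0 ?expR_ge0// addr_ge0// ltW.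
  move=> l n x l1 n0 x1.
  pose r : R := 1 + n.+1%:R^-1.
  have ni0 : 0 < n.+1%:R^-1 :> R by rewrite invr_gt0 ltr0n.
  have ni1 : n.+1%:R^-1 < 1 :> R by rewrite invf_lt1 ?ltr1n.
  have r1 : 1 <= r by rewrite lerDl ltW.
  have r12 : 1 < r < 2 by rewrite ltrDl ni0 ltrD2l.
  pose D := (C + 1) * n.+1%:R `^ beta.
  have D0 : 0 <= D by rewrite mulr_ge0 ?powR_ge0// addr_ge0// ltW.
  apply: (@le_trans _ _ (2 * r ^+ n.+1 * D)); last first.
    by rewrite -[leRHS]mulrA ler_wpM2r// ler_wpM2l// expr1Dinv_le.
  (* The Kreiss bound starts at index 1, so the partial sum [k = 0] is treated apart: it is
     [r^-1 *: x], of norm at most 1. *)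
  apply: sum_of_damped_le => // -[_|k kn]; last first.
    rewrite (le_trans (TC _ _ _ _ l1 r12 _ x1))// /r addrC addKr.
    rewrite -[n.+1%:R^-1]powR_inv1// -powRrM mulN1r powRN invrK.
    by rewrite ler_wpM2r ?powR_ge0// lerDl.
  rewrite big_nat1 nrm_realZ /= expr1 gtr0_norm ?invr_gt0; last lra.
  have x1' : nrm x <= 1 by rewrite -lecR -nrmE.
  apply: (@le_trans _ _ 1).
    by rewrite mulr_ile1 ?nrm_ge0 ?invr_ge0 ?invf_le1//; lra.
  by rewrite mulr_ege1// lerDr ltW.
(* [M + 1] makes the constant positive and covers the partial sum of index 0, which is [x] alone and
   lies outside the hypothesis. *)
exists (4 * (M + 1) * (6 * beta) `^ beta); split.
  by rewrite !mulr_gt0 ?powR_gt0 ?mulr_gt0//; lra.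
move=> l r n x l1 r12 n0 x1; apply: damped_sum_le => //; first lra.
have x1' : nrm x <= 1 by rewrite -lecR -nrmE.
case=> [|k].
  by rewrite big_nat1 /= (le_trans x1')// mulr_ege1// lerDr.
by rewrite (le_trans (TM _ _ _ l1 _ x1))// ler_wpM2r ?powR_ge0// lerDl.
Qed.
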